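(* Let $R$ be a commutative ring. The graphical calculus $\mathrm{RING}_R$ is universal over $R$-bits: for all $n,m\in\mathbb N$ and every matrix $M$ with entries in $R$ having $2^n$ columns and $2^m$ rows, there is a diagram $D:n\to m$ of $\mathrm{RING}_R$ whose interpretation $\llbracket D\rrbracket$ equals $M$.
   Context: The category of $R$-bits is the PROP whose morphisms $n\to m$ are matrices over $R$ with $2^n$ columns and $2^m$ rows (linear maps $(R^2)^{\otimes n}\to(R^2)^{\otimes m}$ in the standard basis), with composition the matrix product and monoidal product the Kronecker product. $\mathrm{RING}_R$ is the compact closed PROP whose diagrams are built by sequential composition and tensor product from the following generators, interpreted (by a strict symmetric monoidal functor $\llbracket\cdot\rrbracket$) as matrices: - identity wire $\mapsto I_2$; swap $2\to 2$ $\mapsto$ the map $|xy\rangle\mapsto|yx\rangle$; cap $2\to0$ $\mapsto (1\ 0\ 0\ 1)$; cup $0\to2$ $\mapsto (1\ 0\ 0\ 1)^T$; empty diagram $\mapsto 1$; - for each $a\in R$ a state $0\to1$ $\mapsto\begin{pmatrix} 1 \\ a \end{pmatrix}$; - multiplication $2\to1$ $\mapsto\begin{pmatrix} 1&0&0&0 \\ 0&0&0&1 \end{pmatrix}$; - addition $2\to1$ $\mapsto\begin{pmatrix} 1&0&0&0 \\ 0&1&1&0 \end{pmatrix}$. *)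

(* Defs.v *)
From mathcomp Require Import all_boot all_algebra.
From mathcomp Require Import mxtens.

Set Implicit Arguments.
Unset Strict Implicit.
Unset Printing Implicit Defensive.

Import GRing.Theory.
Local Open Scope ring_scope.

(* Hom-sets of the PROP of R-bits.  The basis vector |x_1 ... x_n> has the
   index whose binary digits, most significant first, are x_1 ... x_n. *)
Definition bits (R : Type) (n m : nat) : Type := 'M[R]_(2 ^ m, 2 ^ n).

(* Terms denoting the morphisms n -> m of RING_R.  They are not quotiented by
   the axioms of compact closed PROPs: two terms for the same morphism have the
   same interpretation, so the matrices reached are the same.  The n-wire
   identity is a tensor product of copies of [wire], starting from [empty]. *)
Inductive diagram (R : Type) : nat -> nat -> Type :=
| empty : diagram R 0 0
| wire : diagram R 1 1
| swap : diagram R 2 2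
| cap : diagram R 2 0
| cup : diagram R 0 2
| state (a : R) : diagram R 0 1
| mult : diagram R 2 1
| plus : diagram R 2 1
| seqc (n k m : nat) (D1 : diagram R n k) (D2 : diagram R k m) : diagram R n m
| tens (n1 m1 n2 m2 : nat) (D1 : diagram R n1 m1) (D2 : diagram R n2 m2) :
    diagram R (n1 + n2) (m1 + m2).

Arguments empty {R}.
Arguments wire {R}.
Arguments swap {R}.
Arguments cap {R}.
Arguments cup {R}.
Arguments mult {R}.
Arguments plus {R}.

Definition mx_of_rows (R : pzRingType) (p q : nat) (rows : seq (seq R)) :
    'M[R]_(p, q) :=
  \matrix_(i < p, j < q) (nth [::] rows i)`_j.

Definition kron (R : pzRingType) (n1 m1 n2 m2 : nat)
    (A : bits R n1 m1) (B : bits R n2 m2) : bits R (n1 + n2) (m1 + m2) :=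
  castmx (esym (expnD 2 m1 m2), esym (expnD 2 n1 n2)) (tensmx A B).

(* [seqc D1 D2] is D1 followed by D2, hence the reversed matrix product. *)
Fixpoint interp (R : pzRingType) (n m : nat) (D : diagram R n m) : bits R n m :=
  match D in diagram _ n m return bits R n m with
  | empty => 1%:M
  | wire => 1%:M
  | swap => mx_of_rows (2 ^ 2) (2 ^ 2)
      [:: [:: 1; 0; 0; 0];
          [:: 0; 0; 1; 0];
          [:: 0; 1; 0; 0];
          [:: 0; 0; 0; 1]]
  | cap => mx_of_rows (2 ^ 0) (2 ^ 2) [:: [:: 1; 0; 0; 1]]
  | cup => mx_of_rows (2 ^ 2) (2 ^ 0) [:: [:: 1]; [:: 0]; [:: 0]; [:: 1]]
  | state a => mx_of_rows (2 ^ 1) (2 ^ 0) [:: [:: 1]; [:: a]]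
  | mult => mx_of_rows (2 ^ 1) (2 ^ 2)
      [:: [:: 1; 0; 0; 0];
          [:: 0; 0; 0; 1]]
  | plus => mx_of_rows (2 ^ 1) (2 ^ 2)
      [:: [:: 1; 0; 0; 0];
          [:: 0; 1; 1; 0]]
  | seqc _ _ _ D1 D2 => interp D2 *m interp D1
  | tens _ _ _ _ D1 D2 => kron (interp D1) (interp D2)
  end.

(* Main.v *)
Require Import Defs.
From mathcomp Require Import all_boot all_algebra.
From mathcomp Require Import mxtens.

(* Call an endomorphism J of n wires controllable if some diagram represents
   |0> (x) id + |1> (x) J : n -> 1 + n.  Controllable endomorphisms are closed
   under sums and products, by merging two control wires with the addition or
   the multiplication node, and under tensoring with identities.  Scalars are
   controllable by the states, |1><0| by bending one input of the addition node,
   and conjugating it by the bit flip gives all the matrix units of one wire;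
   hence, by induction on n, every endomorphism is controllable.  Contracting
   the control of J - id with the state (1 1) yields J, so every endomorphism is
   represented.  Applying these to |0...0> gives every state, and bending wires
   turns states into arbitrary matrices. *)

Set Implicit Arguments.
Unset Strict Implicit.
Unset Printing Implicit Defensive.

Import GRing.Theory.
Local Open Scope ring_scope.

Section Universality.

Variable R : comPzRingType.

Local Notation bits := (bits R).

(** * Algebra of the Kronecker product *)

Lemma kronE n1 m1 n2 m2 (A : bits n1 m1) (B : bits n2 m2)
    (i : 'I_(2 ^ (m1 + m2))) (j : 'I_(2 ^ (n1 + n2)))
    (i1 : 'I_(2 ^ m1)) (i2 : 'I_(2 ^ m2))
    (j1 : 'I_(2 ^ n1)) (j2 : 'I_(2 ^ n2)) :
    (i : nat) = (i1 * 2 ^ m2 + i2)%N -> (j : nat) = (j1 * 2 ^ n2 + j2)%N ->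
  kron A B i j = A i1 j1 * B i2 j2.
Proof.
move=> Ei Ej; rewrite /kron castmxE -(tensmxE A B i1 i2 j1 j2).
by congr (tensmx A B _ _); apply: val_inj; rewrite /= ?Ei ?Ej.
Qed.

Lemma kron_matrixP n1 m1 n2 m2 (A B : bits (n1 + n2) (m1 + m2)) :
    (forall (i1 : 'I_(2 ^ m1)) (i2 : 'I_(2 ^ m2))
            (j1 : 'I_(2 ^ n1)) (j2 : 'I_(2 ^ n2))
            (i : 'I_(2 ^ (m1 + m2))) (j : 'I_(2 ^ (n1 + n2))),
       (i : nat) = (i1 * 2 ^ m2 + i2)%N -> (j : nat) = (j1 * 2 ^ n2 + j2)%N ->
     A i j = B i j) ->
  A = B.
Proof.
move=> AB; apply/matrixP => i j.
set i' := mxtens_unindex (cast_ord (expnD 2 m1 m2) i).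
set j' := mxtens_unindex (cast_ord (expnD 2 n1 n2) j).
by apply: (AB i'.1 i'.2 j'.1 j'.2); rewrite /= -divn_eq.
Qed.

Lemma kronDl n1 m1 n2 m2 (A B : bits n1 m1) (C : bits n2 m2) :
  kron (A + B) C = kron A C + kron B C.
Proof.
apply: kron_matrixP => i1 i2 j1 j2 i j Ei Ej.
by rewrite !(mxE, kronE _ _ Ei Ej) mulrDl.
Qed.

Lemma kronDr n1 m1 n2 m2 (A : bits n1 m1) (B C : bits n2 m2) :
  kron A (B + C) = kron A B + kron A C.
Proof.
apply: kron_matrixP => i1 i2 j1 j2 i j Ei Ej.
by rewrite !(mxE, kronE _ _ Ei Ej) mulrDr.
Qed.

Lemma kron0l n1 m1 n2 m2 (C : bits n2 m2) : kron (0 : bits n1 m1) C = 0.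
Proof.
apply: kron_matrixP => i1 i2 j1 j2 i j Ei Ej.
by rewrite !(mxE, kronE _ _ Ei Ej) mul0r.
Qed.

Lemma kron0r n1 m1 n2 m2 (A : bits n1 m1) : kron A (0 : bits n2 m2) = 0.
Proof.
apply: kron_matrixP => i1 i2 j1 j2 i j Ei Ej.
by rewrite !(mxE, kronE _ _ Ei Ej) mulr0.
Qed.

Lemma kron_scal n m (a : R) (B : bits n m) : kron (a%:M : bits 0 0) B = a *: B.
Proof.
(* [0 + n] and [n] are convertible, so [B] itself can be indexed with an empty left factor. *)
apply: (@kron_matrixP 0 0) => i1 i2 j1 j2 i j Ei Ej.
have ord1_0 (k : 'I_(2 ^ 0)) : k = ord0 :> 'I_1 := ord1 k.
rewrite (kronE _ _ Ei Ej) !mxE (ord1_0 i1) (ord1_0 j1).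
rewrite (ord1_0 i1) in Ei; rewrite (ord1_0 j1) in Ej.
by congr (_ * B _ _); apply: val_inj.
Qed.

Lemma kron1l n m (B : bits n m) : kron (1%:M : bits 0 0) B = B.
Proof. by rewrite kron_scal scale1r. Qed.

Lemma kron11 n m : kron (1%:M : bits n n) (1%:M : bits m m) = 1%:M.
Proof.
apply: kron_matrixP => i1 i2 j1 j2 i j Ei Ej.
rewrite (kronE _ _ Ei Ej) !mxE -natrM mulnb -!val_eqE /= Ei Ej.
by rewrite eq_addl_mul // xpair_eqE.
Qed.

Lemma kron_mul n1 k1 m1 n2 k2 m2 (A : bits k1 m1) (B : bits k2 m2)
    (C : bits n1 k1) (D : bits n2 k2) :
  kron A B *m kron C D = kron (A *m C) (B *m D).
Proof.
rewrite /kron -tensmx_mul castmx_mul mulmx_cast castmx_comp /=.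
by congr (_ *m _); congr (castmx (_, _) _); apply: nat_irrelevance.
Qed.

(* Associativity is stated on entries because the two sides live in different
   types; when [A] has 0 or 1 wires on each side, these types are
   convertible and no cast is needed. *)
Lemma kronA_entry n1 m1 n2 m2 n3 m3 (A : bits n1 m1) (B : bits n2 m2)
    (C : bits n3 m3) (i : 'I_(2 ^ (m1 + m2 + m3))) (j : 'I_(2 ^ (n1 + n2 + n3)))
    (i' : 'I_(2 ^ (m1 + (m2 + m3)))) (j' : 'I_(2 ^ (n1 + (n2 + n3)))) :
    (i : nat) = (i' : nat) -> (j : nat) = (j' : nat) ->
  kron (kron A B) C i j = kron A (kron B C) i' j'.
Proof.
move=> Ei Ej; rewrite /kron !(castmxE, mxE) -mulrA.
(* These three identities extract the high, middle and low groups of binary digits. *)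
have divA a b c : (a %/ 2 ^ c %/ 2 ^ b = a %/ 2 ^ (b + c))%N.
  by rewrite -divnMA -expnD addnC.
have modA a b c : (a %/ 2 ^ c %% 2 ^ b = a %% 2 ^ (b + c) %/ 2 ^ c)%N.
  by rewrite expnD modn_divl.
have modB a b c : (a %% 2 ^ c = a %% 2 ^ (b + c) %% 2 ^ c)%N.
  by rewrite modn_dvdm // expnD dvdn_mull.
congr (A _ _ * (B _ _ * C _ _)); apply: val_inj; rewrite /= ?Ei ?Ej.
all: by [apply: divA | apply: modA | apply: modB].
Qed.

(** * Block matrices selected by the first wire *)

Definition ket (b : bool) : bits 0 1 := \matrix_(i, j) (i == b :> nat)%:R.
Definition bra (b : bool) : bits 1 0 := \matrix_(i, j) (j == b :> nat)%:R.

Definition ketb (b : bool) n m (A : bits n m) : bits n (1 + m) :=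
  kron (ket b) A.
Definition brab (b : bool) n m (A : bits n m) : bits (1 + n) m :=
  kron (bra b) A.

(* [colb A B] stacks A over B, and [rowb A B] puts A to the left of B: the
   first output, resp. input, wire selects the block. *)
Definition colb n m (A B : bits n m) : bits n (1 + m) :=
  ketb false A + ketb true B.
Definition rowb n m (A B : bits n m) : bits (1 + n) m :=
  brab false A + brab true B.

Lemma bra_ket b c : bra b *m ket c = (b == c)%:R%:M :> bits 0 0.
Proof.
apply/matrixP => i j; rewrite !mxE !big_ord_recl big_ord0 !mxE [i]ord1 [j]ord1.
by case: b; case: c; rewrite /= ?mulr0 ?mulr1 ?addr0 ?add0r.
Qed.

Lemma ket_bra : ket false *m bra false + ket true *m bra true = 1%:M.
Proof.
apply/matrixP => i j; rewrite !mxE !big_ord_recl !big_ord0 !mxE.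
by case: i => [[|[|i]] Hi] //; case: j => [[|[|j]] Hj] //;
  rewrite /= ?mulr0 ?mulr1 ?addr0 ?add0r.
Qed.

Lemma kron_colb n m p q (A B : bits n m) (C : bits p q) :
  kron (colb A B) C = colb (kron A C) (kron B C).
Proof.
rewrite kronDl; congr (_ + _); apply/matrixP => i j;
  exact: (@kronA_entry 0 1 n m p q).
Qed.

Lemma kron_rowb n m p q (A B : bits n m) (C : bits p q) :
  kron (rowb A B) C = rowb (kron A C) (kron B C).
Proof.
rewrite kronDl; congr (_ + _); apply/matrixP => i j;
  exact: (@kronA_entry 1 0 n m p q).
Qed.

Lemma mul_kron1_ketb b n m k (X : bits m k) (A : bits n m) :
  kron (1%:M : bits 1 1) X *m ketb b A = ketb b (X *m A).
Proof. by have := @kron_mul 0 1 1 n m k 1%:M X (ket b) A; rewrite mul1mx. Qed.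

Lemma mul_brab_kron1 b n m k (X : bits k n) (A : bits n m) :
  brab b A *m kron (1%:M : bits 1 1) X = brab b (A *m X).
Proof. by have := @kron_mul 1 1 0 k n m (bra b) A 1%:M X; rewrite mulmx1. Qed.

Lemma mul_ketb b n m k (A : bits n m) (X : bits k n) :
  ketb b A *m X = ketb b (A *m X).
Proof.
by have := @kron_mul 0 0 1 k n m (ket b) A 1%:M X; rewrite kron1l mulmx1.
Qed.

Lemma mul_brab b n m k (X : bits m k) (A : bits n m) :
  X *m brab b A = brab b (X *m A).
Proof.
by have := @kron_mul 1 0 0 n m k 1%:M X (bra b) A; rewrite kron1l mul1mx.
Qed.

Lemma mul_brab_ketb b c n m k (A : bits k m) (B : bits n k) :
  brab b A *m ketb c B = (b == c)%:R *: (A *m B).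
Proof.
by have := @kron_mul 0 1 0 n k m (bra b) A (ket c) B; rewrite bra_ket kron_scal.
Qed.

Lemma mul_ketb_brab b n m k (A : bits k m) (B : bits n k) :
  ketb b A *m brab b B = kron (ket b *m bra b) (A *m B).
Proof. exact: (@kron_mul 1 0 1 n k m). Qed.

Lemma mul_kron1_colb n m k (X : bits m k) (A B : bits n m) :
  kron (1%:M : bits 1 1) X *m colb A B = colb (X *m A) (X *m B).
Proof. by rewrite mulmxDr !mul_kron1_ketb. Qed.

Lemma mul_rowb_kron1 n m k (X : bits k n) (A B : bits n m) :
  rowb A B *m kron (1%:M : bits 1 1) X = rowb (A *m X) (B *m X).
Proof. by rewrite mulmxDl !mul_brab_kron1. Qed.

Lemma mul_colb n m k (A B : bits n m) (X : bits k n) :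
  colb A B *m X = colb (A *m X) (B *m X).
Proof. by rewrite mulmxDl !mul_ketb. Qed.

Lemma mul_rowb n m k (X : bits m k) (A B : bits n m) :
  X *m rowb A B = rowb (X *m A) (X *m B).
Proof. by rewrite mulmxDr !mul_brab. Qed.

Lemma mul_rowb_colb n m k (A B : bits k m) (C D : bits n k) :
  rowb A B *m colb C D = A *m C + B *m D.
Proof.
by rewrite mulmxDl !mulmxDr !mul_brab_ketb /= !scale0r !scale1r add0r addr0.
Qed.

Lemma colbD n m (A B C D : bits n m) :
  colb A B + colb C D = colb (A + C) (B + D).
Proof. by rewrite /colb /ketb !kronDr addrACA. Qed.

Lemma rowbD n m (A B C D : bits n m) :
  rowb A B + rowb C D = rowb (A + C) (B + D).
Proof. by rewrite /rowb /brab !kronDr addrACA. Qed.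

Lemma colb00 n m : colb (0 : bits n m) 0 = 0.
Proof. by rewrite /colb /ketb !kron0r addr0. Qed.

Lemma rowb00 n m : rowb (0 : bits n m) 0 = 0.
Proof. by rewrite /rowb /brab !kron0r addr0. Qed.

Lemma rowb_colb n m (A B C D : bits n m) :
  rowb (colb A B) (colb C D) = colb (rowb A C) (rowb B D).
Proof.
(* This makes [rowb] a sum of right multiplications, which act on each block of a [colb]
   separately. *)
have E p q (X Y : bits p q) : rowb X Y = X *m rowb 1%:M 0 + Y *m rowb 0 1%:M.
  by rewrite !mul_rowb !mulmx1 !mulmx0 rowbD addr0 add0r.
by rewrite E !mul_colb colbD -!E.
Qed.

(** The identity of the first wire splits as |0><0| + |1><1|. *)
Lemma one_blocks n :
  1%:M = rowb (colb 1%:M 0) (colb 0 1%:M) :> bits (1 + n) (1 + n).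
Proof.
rewrite -kron11 -ket_bra kronDl -[1%:M in LHS]mulmx1 -!mul_ketb_brab.
have K b : ketb b 1%:M =
    (if b then colb 0 1%:M else colb 1%:M 0) :> bits n (1 + n).
  by case: b; rewrite /colb /ketb kron0r ?addr0 ?add0r.
have B b : brab b 1%:M =
    (if b then rowb 0 1%:M else rowb 1%:M 0) :> bits (1 + n) n.
  by case: b; rewrite /rowb /brab kron0r ?addr0 ?add0r.
rewrite !K !B /= !mul_rowb !mul_colb !mulmx1 !mulmx0 !colb00.
by rewrite rowbD addr0 add0r.
Qed.

Lemma rowb_ex n m (M : bits (1 + n) m) : exists A B, M = rowb A B.
Proof.
exists (M *m colb 1%:M 0), (M *m colb 0 1%:M).
by rewrite -mul_rowb -one_blocks mulmx1.
Qed.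

Lemma colb_ex n m (M : bits n (1 + m)) : exists A B, M = colb A B.
Proof.
exists (rowb 1%:M 0 *m M), (rowb 0 1%:M *m M).
by rewrite -mul_colb -rowb_colb -one_blocks mul1mx.
Qed.

(** * Block forms of the generators *)

Ltac bit_cases :=
  rewrite /rowb /colb /brab /ketb /kron; apply/matrixP => ? ?;
  rewrite !(mxE, castmxE);
  do 2!match goal with x : 'I__ |- _ =>
    move: x; case=> [[|[|[|[|?]]]] ?] //= end;
  rewrite ?(mul0r, mul1r, mulr0, mulr1, add0r, addr0).

Lemma interp_swap : interp swap =
  rowb (rowb (colb (colb 1%:M 0) 0) (colb 0 (colb 1%:M 0)))
       (rowb (colb (colb 0 1%:M) 0) (colb 0 (colb 0 1%:M))) :> bits 2 2.
Proof. by bit_cases. Qed.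

Lemma interp_cap : interp cap = rowb (rowb 1%:M 0) (rowb 0 1%:M) :> bits 2 0.
Proof. by bit_cases. Qed.

Lemma interp_cup : interp cup = colb (colb 1%:M 0) (colb 0 1%:M) :> bits 0 2.
Proof. by bit_cases. Qed.

Lemma interp_state a : interp (state a) = colb 1%:M a%:M :> bits 0 1.
Proof. by bit_cases. Qed.

Lemma interp_mult : interp mult =
  rowb (rowb (colb 1%:M 0) 0) (rowb 0 (colb 0 1%:M)) :> bits 2 1.
Proof. by bit_cases. Qed.

Lemma interp_plus : interp plus =
  rowb (rowb (colb 1%:M 0) (colb 0 1%:M)) (rowb (colb 0 1%:M) 0) :> bits 2 1.
Proof. by bit_cases. Qed.

Lemma kron_swap1 n : kron (interp swap) (1%:M : bits n n) =
  rowb (rowb (colb (colb 1%:M 0) 0) (colb 0 (colb 1%:M 0)))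
       (rowb (colb (colb 0 1%:M) 0) (colb 0 (colb 0 1%:M)))
    :> bits (2 + n) (2 + n).
Proof.
by rewrite interp_swap !(kron_rowb, kron_colb, kron0l) !kron11.
Qed.

Lemma kron_cap1 n : kron (interp cap) (1%:M : bits n n) =
  rowb (rowb 1%:M 0) (rowb 0 1%:M) :> bits (2 + n) n.
Proof. by rewrite interp_cap !(kron_rowb, kron0l) !kron11. Qed.

Lemma kron_cup1 n : kron (interp cup) (1%:M : bits n n) =
  colb (colb 1%:M 0) (colb 0 1%:M) :> bits n (2 + n).
Proof. by rewrite interp_cup !(kron_colb, kron0l) !kron11. Qed.

Lemma kron_state1 a n :
  kron (interp (state a)) (1%:M : bits n n) = colb 1%:M a%:M :> bits n (1 + n).
Proof. by rewrite interp_state !kron_colb !kron_scal scale1r scalemx1. Qed.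

Lemma kron_mult1 n : kron (interp mult) (1%:M : bits n n) =
  rowb (rowb (colb 1%:M 0) 0) (rowb 0 (colb 0 1%:M)) :> bits (2 + n) (1 + n).
Proof. by rewrite interp_mult !(kron_rowb, kron_colb, kron0l) !kron11. Qed.

Lemma kron_plus1 n : kron (interp plus) (1%:M : bits n n) =
  rowb (rowb (colb 1%:M 0) (colb 0 1%:M)) (rowb (colb 0 1%:M) 0)
    :> bits (2 + n) (1 + n).
Proof. by rewrite interp_plus !(kron_rowb, kron_colb, kron0l) !kron11. Qed.

(** * Matrices represented by diagrams, and wire bending *)

Definition reach n m (M : bits n m) := exists D : diagram R n m, interp D = M.

Lemma reach_mul n k m (A : bits n k) (B : bits k m) :
  reach A -> reach B -> reach (B *m A).
Proof. by case=> D <- [E <-]; exists (seqc D E). Qed.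

Lemma reach_kron n1 m1 n2 m2 (A : bits n1 m1) (B : bits n2 m2) :
  reach A -> reach B -> reach (kron A B).
Proof. by case=> D <- [E <-]; exists (tens D E). Qed.

Lemma reach1 n : reach (1%:M : bits n n).
Proof.
elim: n => [|n [D ID]]; first by exists empty.
by exists (tens wire D); rewrite /= ID kron11.
Qed.

Lemma reach_kron1 n m p (A : bits n m) :
  reach A -> reach (kron A (1%:M : bits p p)).
Proof. by move=> rA; apply: reach_kron (reach1 p). Qed.

Lemma reach_wire n m (A : bits n m) :
  reach A -> reach (kron (1%:M : bits 1 1) A).
Proof. exact/reach_kron/reach1. Qed.

Lemma reach_interp n m (D : diagram R n m) : reach (interp D).
Proof. by exists D. Qed.

(** The cup is |00> + |11>: one of its ends feeds the block selector, the other becomes the first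
    output. *)
Lemma reach_bend n m (A B : bits n m) : reach (rowb A B) -> reach (colb A B).
Proof.
move=> rAB.
have := reach_mul (reach_kron1 n (reach_interp cup)) (reach_wire rAB).
rewrite kron_cup1 mul_kron1_colb !mul_rowb_colb.
by rewrite !mulmx1 !mulmx0 addr0 add0r.
Qed.

Lemma reach_unbend n m (A B : bits n m) : reach (colb A B) -> reach (rowb A B).
Proof.
move=> rAB.
have := reach_mul (reach_wire rAB) (reach_kron1 m (reach_interp cap)).
rewrite kron_cap1 mul_rowb_kron1 !mul_rowb_colb.
by rewrite !mul1mx !mul0mx addr0 add0r.
Qed.

(** Once bent into an input, the first wire receives the state (1 a), which weights the two
    blocks. *)
Lemma reach_feed a n m (A B : bits n m) :
  reach (colb A B) -> reach (A + a *: B).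
Proof.
move=> /reach_unbend rAB.
have := reach_mul (reach_kron1 n (reach_interp (state a))) rAB.
by rewrite kron_state1 mul_rowb_colb mulmx1 mul_mx_scalar.
Qed.

Lemma reach_swap n m (A B C D : bits n m) :
  reach (colb (colb A B) (colb C D)) -> reach (colb (colb A C) (colb B D)).
Proof.
move=> rABCD.
have := reach_mul rABCD (reach_kron1 m (reach_interp swap)).
rewrite kron_swap1 !(mul_rowb_colb, mul_colb).
by rewrite !mul1mx !mul0mx !colbD !(addr0, add0r) !colbD !(addr0, add0r).
Qed.

(** * Closure properties of controllable endomorphisms *)

(* The control is the first output wire: its |0> branch is the identity and its
   |1> branch is J.  Merging the control wires of two such diagrams by [plus]
   kills the branch where both are |1>, so that J and K add up; merging them by
   [mult] kills the two branches where they differ, so that J and K compose. *)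
Local Notation ctrl J := (reach (colb 1%:M J)).

Lemma ctrl_add n (J K : bits n n) :
  ctrl J -> ctrl K -> ctrl (J + K).
Proof.
move=> rJ rK.
have := reach_mul (reach_mul rK (reach_wire rJ))
  (reach_kron1 n (reach_interp plus)).
rewrite kron_plus1 mul_kron1_colb !mul_colb !mul_rowb_colb.
rewrite !mul_colb !colbD !mul0mx !mul1mx mulmx1.
by rewrite !(addr0, add0r) colbD addr0.
Qed.

Lemma ctrl_mul n (J K : bits n n) :
  ctrl J -> ctrl K -> ctrl (J *m K).
Proof.
move=> rJ rK.
have := reach_mul (reach_mul rK (reach_wire rJ))
  (reach_kron1 n (reach_interp mult)).
rewrite kron_mult1 mul_kron1_colb !mul_colb !mul_rowb_colb.
by rewrite !mul_colb !mul1mx !mul0mx !(addr0, add0r) colbD addr0 add0r.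
Qed.

Lemma ctrl_kron1 n m (J : bits n n) :
  ctrl J -> ctrl (kron J (1%:M : bits m m)).
Proof. by move=> /(reach_kron1 m); rewrite kron_colb kron11. Qed.

Lemma kron_wire n m (A : bits n m) :
  kron (1%:M : bits 1 1) A = rowb (colb A 0) (colb 0 A).
Proof.
rewrite (one_blocks 0) kron_rowb !kron_colb !kron1l.
by rewrite !kron0l.
Qed.

Lemma ctrl_wire n (J : bits n n) :
  ctrl J -> ctrl (kron (1%:M : bits 1 1) J).
Proof.
move=> /reach_wire; rewrite kron_wire rowb_colb -colb00 !rowb_colb.
(* The added wire comes before the control wire; the swap puts the control first again. *)
move=> /reach_swap.
by rewrite kron_wire one_blocks !rowb_colb.
Qed.

(** The tensor product factors as (E (x) id)(id (x) J). *)
Lemma ctrl_kron n (E : bits 1 1) (J : bits n n) :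
  ctrl E -> ctrl J -> ctrl (kron E J).
Proof.
move=> /(ctrl_kron1 n) rE /ctrl_wire rJ.
by have := ctrl_mul rE rJ; rewrite kron_mul mulmx1 mul1mx.
Qed.

(** * Matrix units of one wire *)

(* [unitrc] is |r><c|. *)
Definition unit00 : bits 1 1 := rowb (colb 1%:M 0) 0.
Definition unit10 : bits 1 1 := rowb (colb 0 1%:M) 0.
Definition unit01 : bits 1 1 := rowb 0 (colb 1%:M 0).
Definition unit11 : bits 1 1 := rowb 0 (colb 0 1%:M).
Definition flip : bits 1 1 := rowb (colb 0 1%:M) (colb 1%:M 0).

Ltac block_simp :=
  rewrite /flip /unit00 /unit01 /unit10 /unit11 !mul_rowb !mul_rowb_colb
    ?(mulmx0, mulmx1, addr0, add0r).

Lemma flip_flip : flip *m flip = 1%:M.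
Proof. by block_simp; rewrite -(one_blocks 0). Qed.

Lemma unit00_unit10 : unit00 *m unit10 = 0.
Proof. by block_simp; rewrite rowb00. Qed.

Lemma flip_unit10 : flip *m unit10 = unit00.
Proof. by block_simp. Qed.

Lemma flip_unit10_flip : flip *m unit10 *m flip = unit01.
Proof. by block_simp. Qed.

Lemma unit01_unit10 : unit01 *m unit10 = unit00.
Proof. by block_simp. Qed.

Lemma unit10_unit01 : unit10 *m unit01 = unit11.
Proof. by block_simp. Qed.

(** Addition with first input |0> is the identity, and with first input |1> it is |1><0|. *)
Lemma ctrl_unit10 : ctrl unit10.
Proof.
apply: reach_bend; rewrite (one_blocks 0) /unit10 -interp_plus.
exact: reach_interp.
Qed.

Lemma reach_flip : reach flip.
Proof.
(* flip = (|0><0| + flip) (1 - |1><0|).  Both factors come from [plus] with one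
   input bent: as a map 1 -> 2 it is |0> (x) id + |1> (x) |1><0|, and after
   swapping its outputs |0> (x) |0><0| + |1> (x) flip. *)
have r10 := reach_feed (-1) ctrl_unit10.
have rX : reach (colb unit00 flip).
  rewrite /unit00 /flip -colb00 !rowb_colb; apply: reach_swap.
  by rewrite -2!rowb_colb -(one_blocks 0) colb00; apply: ctrl_unit10.
have := reach_mul r10 (reach_feed 1 rX).
rewrite scale1r mulmxDr mulmx1 -scalemxAr mulmxDl unit00_unit10 flip_unit10.
by rewrite add0r scaleN1r addrAC subrr add0r.
Qed.

(** Since [flip] is an involution, conjugation by it preserves the identity branch. *)
Lemma ctrl_flip (J : bits 1 1) :
  ctrl J -> ctrl (flip *m J *m flip).
Proof.
move=> rJ; have := reach_mul (reach_mul reach_flip rJ) (reach_wire reach_flip).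
by rewrite mul_colb mul_kron1_colb mul1mx mulmxA flip_flip.
Qed.

Lemma ctrl_unit01 : ctrl unit01.
Proof. by rewrite -flip_unit10_flip; apply/ctrl_flip/ctrl_unit10. Qed.

Lemma ctrl_unit00 : ctrl unit00.
Proof. by rewrite -unit01_unit10; apply: ctrl_mul ctrl_unit01 ctrl_unit10. Qed.

Lemma ctrl_unit11 : ctrl unit11.
Proof. by rewrite -unit10_unit01; apply: ctrl_mul ctrl_unit10 ctrl_unit01. Qed.

(** * From endomorphisms to all matrices *)

Lemma ctrl_all n (J : bits n n) : ctrl J.
Proof.
elim: n J => [|n IH] J.
  (* On 0 wires [J] is a scalar, and its control is a state. *)
  by rewrite [J](mx11_scalar (J : 'M_1)) -interp_state; apply: reach_interp.
have [A [B ->]] := rowb_ex J; have [A0 [A1 ->]] := colb_ex A.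
have [B0 [B1 ->]] := colb_ex B.
have -> : rowb (colb A0 A1) (colb B0 B1) =
  kron unit00 A0 + kron unit10 A1 + (kron unit01 B0 + kron unit11 B1).
  rewrite !(kron_rowb, kron_colb, kron0l) !kron1l.
  by rewrite !rowbD !colbD !(addr0, add0r).
by do 2!apply: ctrl_add; apply: ctrl_kron => //;
  [apply: ctrl_unit00 | apply: ctrl_unit10
  | apply: ctrl_unit01 | apply: ctrl_unit11].
Qed.

Lemma reach_endo n (J : bits n n) : reach J.
Proof.
by have := reach_feed 1 (ctrl_all (J - 1%:M)); rewrite scale1r addrC subrK.
Qed.

(** Here [z] is |0...0>; its left inverse [u] serves to form, for any state [v], the endomorphism
    [v *m u] sending [z] to [v]. *)
Lemma reach_section n :
  exists2 z : bits 0 n, reach z & exists u : bits n 0, u *m z = 1%:M.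
Proof.
elim: n => [|n [z rz [u uz]]].
  by exists 1%:M; [apply: reach1 | exists 1%:M; rewrite mulmx1].
exists (colb z 0); last first.
  by exists (rowb u 0); rewrite mul_rowb_colb mulmx0 addr0.
have := reach_mul rz (reach_kron1 n (reach_interp (state 0))).
by rewrite kron_state1 mul_colb mul1mx mul_scalar_mx scale0r.
Qed.

Lemma reach_state n (v : bits 0 n) : reach v.
Proof.
have [z rz [u uz]] := reach_section n.
by have := reach_mul rz (reach_endo (v *m u)); rewrite -mulmxA uz mulmx1.
Qed.

Lemma reach_all n m (M : bits n m) : reach M.
Proof.
(* The number [m] of outputs varies, since bending an input adds an output. *)
elim: n m M => [|n IH] m M; first exact: reach_state.
have [A [B ->]] := rowb_ex M; exact/reach_unbend/IH.
Qed.

End Universality.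

Theorem theorem4p5 (R : comPzRingType) (n m : nat) (M : 'M[R]_(2 ^ m, 2 ^ n)) :
  exists D : diagram R n m, interp D = M.
Proof. exact: reach_all. Qed.
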